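(* For every integer $n\geq 2$, $$\left|\mathsf{APS}^B_n\right| = \sum_{k=0}^{\left\lfloor\frac{n-1}{2}\right\rfloor}\binom{n}{k} \binom{n-1-k}{\left\lfloor\frac{n-1}{2}\right\rfloor-k}.$$
   Context: For $n\in\mathbb{N}$, $[n]=\{1,\dots,n\}$ and $\pm[n]=[n]\cup -[n]$. The group $\mathfrak{S}_n^B$ of signed permutations consists of the bijections $w:\pm[n]\to\pm[n]$ with $w(-i)=-w(i)$ for all $i$; it is written in one-line notation $w(1)w(2)\cdots w(n)$. A pinnacle of $w$ is a value $w(i)$ with $2\le i\le n-1$ and $w(i-1)<w(i)>w(i+1)$; the pinnacle set of $w$ is the set of its pinnacles. $\mathsf{APS}^B_n$ denotes the set of all subsets $S\subseteq \pm[n]$ that occur as the pinnacle set of some $w\in\mathfrak{S}_n^B$. *)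

(* Defs.v *)
From mathcomp Require Import all_boot all_order all_fingroup all_algebra.

Set Implicit Arguments.
Unset Strict Implicit.
Unset Printing Implicit Defensive.

(* An element of ±[n] is a sign (true for negative) together with an index
   i : 'I_n, which stands for the absolute value i + 1. *)
Definition pm (n : nat) : Type := (bool * 'I_n)%type.

Definition pm_val (n : nat) (x : pm n) : int :=
  if x.1 then (- (x.2.+1)%:Z)%R else (x.2.+1)%:Z%R.

Definition pm_opp (n : nat) (x : pm n) : pm n := (~~ x.1, x.2).

Definition pm_pos (n : nat) (i : 'I_n) : pm n := (false, i).

Definition pm_lt (n : nat) (x y : pm n) : bool := (pm_val x < pm_val y)%R.

Lemma pm_val_inj (n : nat) : injective (@pm_val n).
Proof.
move=> [[] i] [[] j]; rewrite /pm_val /=.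
- by move=> /GRing.oppr_inj [] /val_inj ->.
- by [].
- by [].
- by move=> [] /val_inj ->.
Qed.

Lemma pm_val_opp (n : nat) (x : pm n) : pm_val (pm_opp x) = (- pm_val x)%R.
Proof. by case: x => [[] i]; rewrite /pm_val /= ?GRing.opprK. Qed.

Lemma pm_val_range (n : nat) (z : int) :
  (exists x : pm n, pm_val x = z) <-> 0 < `|z|%N <= n.
Proof.
split=> [[[[] i] <-]|]; rewrite /pm_val /= ?abszN ?absz_nat ?ltn_ord //.
case: z => [[|m]|m] //= Hm.
  by exists (false, Ordinal Hm).
by exists (true, Ordinal Hm).
Qed.

Definition signed_perms (n : nat) : {set {perm pm n}} :=
  [set w : {perm pm n} | [forall x : pm n, w (pm_opp x) == pm_opp (w x)]].

(* i, j, k are consecutive positions, so j is neither the first nor the last. *)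
Definition pinnacle_set (n : nat) (w : {perm pm n}) : {set pm n} :=
  [set x : pm n | [exists i : 'I_n, exists j : 'I_n, exists k : 'I_n,
     [&& j == i.+1 :> nat, k == j.+1 :> nat, x == w (pm_pos j),
         pm_lt (w (pm_pos i)) (w (pm_pos j))
       & pm_lt (w (pm_pos k)) (w (pm_pos j))]]].

Definition APSB (n : nat) : {set {set pm n}} :=
  [set pinnacle_set w | w in signed_perms n].

(* Main.v *)
(** In a signed permutation the non-pinnacles may be taken negative, which only
lowers them. With [k] pinnacles [s_0 < s_1 < ...] and non-pinnacles
[v_0 < v_1 < ...], the arrangement [v_0 s_0 v_1 s_1 ... v_k v_(k+1) ...] works
as soon as [v_(i+1) < s_i] for all [i]; this is also necessary, because [m]
pinnacles have at least [m + 1] neighbours, all of them smaller non-pinnacles.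
So [S] is admissible iff [2 k < n] and every negative pinnacle [-a] satisfies a
ballot condition on the absolute values at least [a]. The words with [p]
positive pinnacles and at most [r] negative ones satisfying the ballot
condition number ['C(n, p) * 'C(n - p - 1, r)], by induction on [n]; take
[r = (n - 1) %/ 2 - p] and sum over [p]. *)

Require Import Defs.
From mathcomp Require Import all_boot all_order all_fingroup all_algebra.
From mathcomp Require Import zify.

Set Implicit Arguments.
Unset Strict Implicit.
Unset Printing Implicit Defensive.

Import Order.TTheory.

(** * Counting ballot words *)

Lemma card_tupleS (T : finType) (L : nat) (Q : pred (seq T)) :
  #|[set t : L.+1.-tuple T | Q t]|
    = \sum_(x : T) #|[set t : L.-tuple T | Q (x :: t)]|.
Proof.
rewrite -sum1_card (partition_big (@thead L T) xpredT) //=.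
apply: eq_bigr => x _; rewrite sum1_card -(@card_imset _ _ (fun t : L.-tuple T => [tuple of x :: t])).
  apply: eq_card => t; apply/idP/imsetP => [|[s]].
    case/tupleP: t => y s; rewrite unfold_in inE theadE => /andP[Qs /eqP eyx].
    by exists s; rewrite ?inE -?eyx.
  by rewrite inE => Qs ->; rewrite unfold_in inE theadE eqxx Qs.
by move=> s t /(congr1 val) [] /val_inj.
Qed.

Lemma sum_option_bool (F : option bool -> nat) :
  \sum_x F x = F None + F (Some false) + F (Some true).
Proof.
rewrite (bigD1 None) // (bigD1 (Some false)) // (bigD1 (Some true)) //=.
by rewrite big1 ?addn0 ?addnA // => -[[]|].
Qed.

(* Letter [i] of a word describes the absolute value [i + 1]: [Some b] if it is
   the absolute value of a pinnacle, negative when [b], and [None] otherwise. *)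
Fixpoint ballot (s : seq (option bool)) : bool :=
  if s is x :: s' then
    ballot s' &&
      ((x == Some true) ==> (count_mem (Some true) s < count_mem None s))
  else true.

Lemma ballotP (s : seq (option bool)) :
  reflect (forall i, i < size s -> nth None s i = Some true ->
             count_mem (Some true) (drop i s) < count_mem None (drop i s))
          (ballot s).
Proof.
elim: s => [|x s IH]; first by apply: ReflectT.
apply: (iffP andP) => [[/IH bs /implyP hx] [_ /= /eqP|i /=]|H].
- exact: hx.
- by rewrite ltnS; exact: bs.
- split; first by apply/IH => i lt_i; exact: (H i.+1).
  by apply/implyP => /eqP xE; exact: (H 0).
Qed.

(** The inequality holds at the first [Some true], and the letters before it can only raise the
    number of [None]. *)
Lemma ballot_count (s : seq (option bool)) :
  ballot s -> 0 < count_mem (Some true) s ->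
  count_mem (Some true) s < count_mem None s.
Proof.
elim: s => [//|[[]|] s IH] /= /andP[/IH bs].
- by [].
- by rewrite !add0n => _ /bs.
- by rewrite add0n => _ /bs lt; apply: leqW.
Qed.

Lemma count_letters (s : seq (option bool)) :
  count_mem None s + count_mem (Some false) s + count_mem (Some true) s = size s.
Proof. by elim: s => [|[[]|] s /= <-] //=; rewrite ?add0n ?add1n ?addnS ?addSn. Qed.

(** Bounding the number of [Some true] instead of fixing it gives a single product of binomials and
    suits a bound on the total number of pinnacles. *)
Definition ballot_card (L p r : nat) : nat :=
  #|[set t : L.-tuple (option bool) |
      [&& ballot t, count_mem (Some false) t == p
        & count_mem (Some true) t <= r]]|.

Lemma ballot_card0 (p r : nat) : ballot_card 0 p r = (p == 0).
Proof.
rewrite /ballot_card; case: p => [|p].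
  rewrite (_ : [set _ | _] = setT) ?cardsT ?card_tuple //.
  by apply/setP => t; rewrite !inE tuple0.
by apply: eq_card0 => t; rewrite !inE tuple0.
Qed.

(* Only the words with [r.+1] occurrences of [Some true] distinguish the two sides;
   they would end at a nonpositive height. *)
Lemma ballot_card_saturate (L p r : nat) :
  r.+1.*2 = L - p -> ballot_card L p r.+1 = ballot_card L p r.
Proof.
move=> LpE; apply: eq_card => t; rewrite !inE; apply: andb_id2l => bt.
apply: andb_id2l => /eqP pE.
move: (ballot_count bt) (count_letters t); rewrite size_tuple.
case: posnP => [-> //|a_gt0] /(_ isT); move: a_gt0 pE.
move: (count_mem _ t) (count_mem _ t) (count_mem _ t) => a b c.
by move=> *; apply/idP/idP; lia.
Qed.

(** Split on the first letter. The hypothesis makes the condition at a leading [Some true]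
    automatic: beside [p] letters [Some false] and at most [r] letters [Some true], more than [r]
    letters are [None]. *)
Lemma ballot_cardS (L p r : nat) : (0 < r -> r.*2 < L.+1 - p) ->
  ballot_card L.+1 p r = ballot_card L p r
    + (if p is p'.+1 then ballot_card L p' r else 0)
    + (if r is r'.+1 then ballot_card L p r' else 0).
Proof.
move=> ltrL; rewrite {1}/ballot_card.
rewrite (card_tupleS _ (fun t => [&& ballot t, count_mem (Some false) t == p
        & count_mem (Some true) t <= r])) sum_option_bool.
congr (_ + _ + _).
- by apply: eq_card => t; rewrite !inE /= andbT.
- case: p ltrL => [|p] ltrL.
    by apply: eq_card0 => t; rewrite !inE /= andbF.
  by apply: eq_card => t; rewrite !inE /= andbT.
- case: r ltrL => [|r] ltrL.
    by apply: eq_card0 => t; rewrite !inE /= !andbF.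
  have {}ltrL := ltrL isT.
  apply: eq_card => t; rewrite !inE /= !add0n !add1n ltnS.
  rewrite -andbA; apply: andb_id2l => bt.
  move: (count_letters t); rewrite size_tuple.
  move: (count_mem _ t) (count_mem _ t) (count_mem _ t) => a b c cE.
  by apply/idP/idP => [/and3P[_ -> ->] //|/andP[/eqP bE ca]]; rewrite bE eqxx; lia.
Qed.

Lemma ballot_cardE (L p r : nat) : r.*2 <= L - p ->
  ballot_card L p r = 'C(L, p) * 'C((L - p).-1, r).
Proof.
elim: L p r => [|L IH] p r lerL.
  by rewrite sub0n in lerL *; rewrite ballot_card0 bin0n; case: r lerL => //; rewrite bin0 muln1.
(* Kept apart because it must cover [p > L], where [L.+1 - p = 0] excludes the strict bound. *)
have card0E : ballot_card L.+1 p 0 = 'C(L.+1, p).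
  rewrite ballot_cardS // addn0 IH // bin0 muln1.
  by case: p {lerL} => [|p]; rewrite ?bin0 // IH // bin0 muln1 binS.
have card_lt q : q.*2 < L.+1 - p ->
    ballot_card L.+1 p q = 'C(L.+1, p) * 'C((L.+1 - p).-1, q).
  case: q => [_|q ltqL]; first by rewrite card0E bin0 muln1.
  rewrite ballot_cardS // !IH; try by lia.
  have [M ME] : exists M, L - p = M.+1 by exists (L - p).-1; lia.
  rewrite subSn ?ME /=; last by lia.
  case: p lerL ltqL ME {card0E} => [|p] lerL ltqL ME.
    by rewrite !bin0 addn0 !mul1n binS.
  rewrite IH; last by lia.
  (* Pascal's rule in the second factor merges the first and third summands; in the first factor it
     then absorbs the middle one. *)
  by rewrite (_ : L - p = M.+2) /= ?binS; [nia | lia].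
case: r lerL => [|r] lerL; first by rewrite card0E bin0 muln1.
have [ltrL|leLr] := ltnP r.+1.*2 (L.+1 - p); first exact: card_lt.
have LpE : r.+1.*2 = L.+1 - p by apply/eqP; rewrite eqn_leq lerL.
rewrite ballot_card_saturate // card_lt; last by lia.
(* What remains is the symmetry ['C(r.*2.+1, r) = 'C(r.*2.+1, r.+1)]. *)
rewrite -LpE; congr (_ * _).
by rewrite -bin_sub; [congr 'C(_, _)|]; lia.
Qed.

Lemma count_drop (T : Type) (x0 : T) (P : pred T) (s : seq T) (i : nat) :
  count P (drop i s) = \sum_(0 <= j < size s) ((i <= j) && P (nth x0 s j)).
Proof.
elim: s i => [|x s IH] [|i] /=; rewrite ?big_nil //.
  by rewrite big_nat_recl //= -(drop0 s) IH drop0.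
by rewrite big_nat_recl //= add0n IH.
Qed.

Lemma count_drop_tuple (T : Type) (n : nat) (t : n.-tuple T) (P : pred T)
    (i : nat) :
  count P (drop i t) = #|[set j : 'I_n | (i <= j) && P (tnth t j)]|.
Proof.
case: n t => [|n] t.
  by rewrite tuple0 /= eq_card0 // => -[].
rewrite (count_drop (thead t)) size_tuple big_mkord -sum1_card [RHS]big_mkcond /=.
by apply: eq_bigr => j _; rewrite inE -tnth_nth; case: (_ && _).
Qed.

Lemma card_tuple_pred (T : Type) (n : nat) (t : n.-tuple T) (P : pred T) :
  #|[set j : 'I_n | P (tnth t j)]| = count P t.
Proof. by rewrite -[in RHS](drop0 t) count_drop_tuple. Qed.

(** Room for [k] pinnacles and at least [k + 1] other values means [2 k < n]. *)
Definition admissible (n : nat) (t : n.-tuple (option bool)) : bool :=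
  ballot t && ((count (predC1 None) t).*2 < n).

Lemma count_some (s : seq (option bool)) :
  count (predC1 None) s = count_mem (Some false) s + count_mem (Some true) s.
Proof. by elim: s => [|[[]|] s /= ->]; rewrite ?add0n ?add1n ?addnS ?addSn. Qed.

Lemma card_admissible (n : nat) : 0 < n ->
  #|[set t : n.-tuple (option bool) | admissible t]| =
    \sum_(0 <= k < ((n - 1) %/ 2).+1)
      'C(n, k) * 'C(n - 1 - k, (n - 1) %/ 2 - k).
Proof.
move=> n_gt0; set m := (n - 1) %/ 2.
have mE : (m.*2 < n) /\ (n <= m.*2.+2) by rewrite /m; lia.
case: mE => lt_mn le_nm; rewrite big_mkord.
have admE (t : n.-tuple (option bool)) : admissible t =
    ballot t && (count_mem (Some false) t + count_mem (Some true) t <= m).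
  rewrite /admissible count_some; congr (_ && _).
  by move: (_ + _) => c; apply/idP/idP; lia.
(* Admissible words have at most [m] letters [Some false], so [inord] keeps the count unchanged on
   them. *)
pose P (t : n.-tuple (option bool)) : 'I_m.+1 := inord (count_mem (Some false) t).
rewrite -sum1_card (partition_big P xpredT) //=.
apply: eq_bigr => k _; rewrite sum1_card.
have le_km := ltn_ord k.
have -> : n - 1 - k = (n - k).-1 by lia.
rewrite -ballot_cardE; last by lia.
apply: eq_card => t; rewrite unfold_in !inE admE -andbA; apply: andb_id2l => _.
rewrite -val_eqE /P /=; set b := count_mem (Some false) t; set a := count_mem _ t.
apply/andP/andP => [[le_ba] | [/eqP bk le_a]].
  by rewrite inordK; [move/eqP => <-; rewrite eqxx; split=> //; lia | lia].
by rewrite inordK ?bk; [split => //; lia | lia].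
Qed.

(** * Words as sets of signed values *)

Definition letter_set (n : nat) (t : n.-tuple (option bool)) : {set pm n} :=
  [set x : pm n | tnth t x.2 == Some x.1].

Lemma letter_set_inj (n : nat) : injective (@letter_set n).
Proof.
move=> s t /setP st; apply: eq_from_tnth => i.
have E b : (tnth s i == Some b) = (tnth t i == Some b).
  by have := st (b, i); rewrite !inE.
move: (E true) (E false).
by case: (tnth s i) => [[]|]; case: (tnth t i) => [[]|].
Qed.

Lemma card_letter_set (n : nat) (t : n.-tuple (option bool)) :
  #|letter_set t| = count (predC1 None) t.
Proof.
rewrite -card_tuple_pred -(card_in_imset (f := snd) (D := letter_set t)).
  apply: eq_card => j; rewrite inE; apply/imsetP/idP => [[[b i]]|/=].
    by rewrite inE /= => /eqP tiE ->; rewrite tiE.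
  by case tjE : (tnth t j) => [b|] // _; exists (b, j); rewrite // inE tjE.
move=> [b i] [c j]; rewrite !inE /= => /eqP tiE /eqP tjE eij.
by move: tjE; rewrite -eij tiE => -[->].
Qed.

Lemma admissibleP (n : nat) (t : n.-tuple (option bool)) :
  reflect
    ((#|letter_set t|.*2 < n) /\
     forall i : 'I_n, tnth t i = Some true ->
       #|[set j : 'I_n | (i <= j) && (tnth t j == Some true)]| <
       #|[set j : 'I_n | (i <= j) && (tnth t j == None)]|)
    (admissible t).
Proof.
rewrite card_letter_set.
apply: (iffP andP) => [[/ballotP bt ltn]|[ltn H]]; split=> //.
  move=> i tiE.
  have := bt i; rewrite size_tuple ltn_ord !count_drop_tuple; apply=> //.
  by rewrite -tnth_nth.
apply/ballotP => i; rewrite size_tuple => lt_in tiE.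
rewrite !count_drop_tuple; apply: (H (Ordinal lt_in)).
by rewrite (tnth_nth None).
Qed.

(** * Necessity: pinnacle sets come from admissible words *)

Lemma card_ltn_neighbours (n : nat) (J K : {set 'I_n}) :
  J != set0 ->
  (forall j, j \in J -> exists i k : 'I_n,
     [/\ i \in K, k \in K, j = i.+1 :> nat & k = j.+1 :> nat]) ->
  #|J| < #|K|.
Proof.
case/set0Pn => j1 Jj1 HJ.
(* Right neighbours inject [J] into [K] and miss the left neighbour [i0] of the least element of
   [J]. *)
have [j0 Jj0 min_j0] := @arg_minnP _ j1 (mem J) val Jj1.
have [i0 [_ [Ki0 _ j0E _]]] := HJ _ Jj0.
rewrite (cardsD1 i0 K) Ki0 add1n ltnS -(card_imset J (@ordS_inj n)).
apply/subset_leq_card/subsetP => _ /imsetP[j Jj ->].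
have [i [k [_ Kk _ kE]]] := HJ _ Jj.
(* The cyclic successor does not wrap here, since [j + 1 = k < n]. *)
have -> : ordS j = k by apply/val_inj; rewrite /= -kE modn_small.
have le_j0j : j0 <= j := min_j0 _ Jj.
by rewrite !inE Kk andbT -val_eqE /= kE; lia.
Qed.

Definition pinnacle_positions (n : nat) (w : {perm pm n}) : {set 'I_n} :=
  [set j | w (pm_pos j) \in pinnacle_set w].

Lemma pinnacle_positionsP (n : nat) (w : {perm pm n}) (j : 'I_n) :
  j \in pinnacle_positions w -> exists i k : 'I_n,
    [/\ j = i.+1 :> nat, k = j.+1 :> nat,
        pm_lt (w (pm_pos i)) (w (pm_pos j)) &
        pm_lt (w (pm_pos k)) (w (pm_pos j))].
Proof.
rewrite !inE => /existsP[i /existsP[j' /existsP[k]]].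
case/and5P=> /eqP j'E /eqP kE /eqP /perm_inj [] jE lt_i lt_k.
by exists i, k; rewrite jE.
Qed.

(** Neighbours of a pinnacle are lower, so they inherit [Q], and they are not pinnacles themselves.
    Taking [predT] for [Q] gives the size bound, a threshold gives the ballot condition. *)
Lemma card_pinnacle_positions (n : nat) (w : {perm pm n}) (Q : pred (pm n)) :
  (forall x y, pm_lt x y -> Q y -> Q x) ->
  [set j in pinnacle_positions w | Q (w (pm_pos j))] != set0 ->
  #|[set j in pinnacle_positions w | Q (w (pm_pos j))]| <
  #|[set j in ~: pinnacle_positions w | Q (w (pm_pos j))]|.
Proof.
move=> Qlt /card_ltn_neighbours; apply=> j; rewrite inE => /andP[Jj Qj].
have [i [k [jE kE lt_i lt_k]]] := pinnacle_positionsP Jj.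
exists i, k; split=> //; rewrite inE (Qlt _ _ _ Qj) // andbT inE; apply/negP.
- case/pinnacle_positionsP=> i' [k' [_ k'E _]].
  have -> : k' = j by apply: val_inj; rewrite /= k'E jE.
  by move: lt_i; rewrite /pm_lt; lia.
- case/pinnacle_positionsP=> i' [k' [i'E _ + _]].
  have -> : i' = j by apply: val_inj => /=; lia.
  by move: lt_k; rewrite /pm_lt; lia.
Qed.

(** Equal absolute values with opposite signs would give [w(i) = w(-j)] with [i] and [j] both
    positive. *)
Lemma signed_perm_abs_inj (n : nat) (w : {perm pm n}) : w \in signed_perms n ->
  injective (fun j : 'I_n => (w (pm_pos j)).2).
Proof.
rewrite inE => /forallP sw i j /= eqij.
have [eq1|] := eqVneq (w (pm_pos i)).1 (w (pm_pos j)).1.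
  suff : w (pm_pos i) = w (pm_pos j) by move=> /perm_inj [].
  by move: eqij eq1; case: (w (pm_pos i)) (w (pm_pos j)) => [b k] [c l] /= -> ->.
move=> neq1; suff : w (pm_pos i) = w (pm_opp (pm_pos j)) by move=> /perm_inj.
rewrite (eqP (sw _)) /pm_opp -eqij; move: neq1.
by case: (w (pm_pos i)) (w (pm_pos j)) => [[] k] [[] l].
Qed.

Lemma pinnacle_set_admissible (n : nat) (w : {perm pm n}) :
  0 < n -> w \in signed_perms n ->
  exists2 t, admissible t & pinnacle_set w = letter_set t.
Proof.
move=> n_gt0 sw; set S := pinnacle_set w; set J := pinnacle_positions w.
have absI := signed_perm_abs_inj sw.
have posS x : x \in S -> exists2 j, j \in J & w (pm_pos j) = x.
  move=> Sx; have := Sx; rewrite inE => /existsP[i /existsP[j /existsP[k]]].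
  by case/and5P=> _ _ /eqP xE _ _; exists j; rewrite // inE -xE.
(* The order of the two tests is harmless: at positive positions [w] takes only one of two opposite
   values. *)
pose t := [tuple if (false, i) \in S then Some false else
                 if (true, i) \in S then Some true else None | i < n].
have SE : S = letter_set t.
  apply/setP => -[b i]; rewrite [RHS]inE tnth_mktuple /=.
  have notboth : (false, i) \in S -> (true, i) \in S -> False.
    move=> /posS[j _ jE] /posS[k _ kE].
    have jk : j = k by apply: absI; rewrite jE kE.
    by move: kE; rewrite -jk jE.
  case: ifP => Sf; last by case: ifP => St; case: b; rewrite ?Sf ?St.
  by case: b => //; apply/negP => /(notboth Sf).
have tpin j : j \in J -> tnth t (w (pm_pos j)).2 = Some (w (pm_pos j)).1.
  by rewrite inE -/S SE inE => /eqP.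
have tnpin j : j \notin J -> tnth t (w (pm_pos j)).2 = None.
  case tjE : (tnth _ _) => [b|] //.
  have /posS[j' Jj' j'E] : (b, (w (pm_pos j)).2) \in S by rewrite SE inE tjE.
  have -> : j = j' by apply: absI; rewrite j'E.
  by rewrite Jj'.
exists t => //; apply/admissibleP; rewrite -SE; split.
  have leSJ : #|S| <= #|J|.
    rewrite -(card_imset J (f := fun j => w (pm_pos j))); last first.
      by move=> i j /perm_inj [].
    apply/subset_leq_card/subsetP => x /posS[j Jj <-]; exact: imset_f.
  have [J0|Jn0] := eqVneq J set0; first by move: leSJ; rewrite J0 cards0; lia.
  have := @card_pinnacle_positions n w predT (fun _ _ _ _ => isT).
  rewrite !setIdE -/J (_ : [set _ | _] = setT); last by apply/setP => ?; rewrite !inE.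
  by rewrite !setIT => /(_ Jn0); have := cardsC J; rewrite card_ord; lia.
move=> i tiE.
(* Values at most [-(i + 1)] are the negative ones whose letter has index at least [i]. *)
pose Q (x : pm n) := (pm_val x <= pm_val (true, i))%R.
have Qlt x y : pm_lt x y -> Q y -> Q x by rewrite /pm_lt /Q; lia.
have Qneg x : Q x -> x.1 = true /\ i <= x.2.
  by case: x => [[] k]; rewrite /Q /pm_val /=; lia.
have Si : (true, i) \in S by rewrite SE inE tiE.
have Jn0 : [set j in J | Q (w (pm_pos j))] != set0.
  have [j Jj jE] := posS _ Si.
  by apply/set0Pn; exists j; rewrite inE Jj jE /Q lexx.
(* Letters [Some true] from index [i] on come from pinnacle positions satisfying [Q]; these are
   outnumbered by the other positions satisfying [Q], whose letters are [None]. *)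
apply: leq_ltn_trans (leq_trans (card_pinnacle_positions Qlt Jn0) _).
  rewrite -/J -(card_imset [set j in J | _] absI).
  apply/subset_leq_card/subsetP => k; rewrite inE => /andP[le_ik /eqP tkE].
  have /posS[j Jj jE] : (true, k) \in S by rewrite SE inE tkE.
  apply/imsetP; exists j; last by rewrite jE.
  by rewrite inE Jj jE /Q /pm_val /=; lia.
rewrite -/J -(card_imset [set j in ~: J | _] absI).
apply/subset_leq_card/subsetP => _ /imsetP[j + ->].
rewrite inE in_setC => /andP[NJj /Qneg[_ le_i]].
by rewrite inE le_i tnpin.
Qed.

Lemma count_enum (T : finType) (A : {set T}) (a : pred T) :
  count a (enum A) = #|[set x in A | a x]|.
Proof. by rewrite -sum1_count big_enum_cond -sum1dep_card. Qed.

(** * Extending one-line notation to a signed permutation *)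

Section SignedPermOfWord.

Variables (n : nat) (u : 'I_n -> pm n).
Hypothesis u_abs_onto : forall a, exists i, (u i).2 = a.

(** The odd extension of [u]: the exclusive or flips the sign at negative arguments. *)
Definition signed_extension (x : pm n) : pm n := (x.1 (+) (u x.2).1, (u x.2).2).

Lemma signed_extension_inj : injective signed_extension.
Proof.
(* A surjection from a finite set to itself is injective. *)
have u_abs_inj : injective (fun i => (u i).2).
  apply/injectiveP/card_uniqP; rewrite size_map -cardT.
  apply: eq_card => a; rewrite !inE; have [i <-] := u_abs_onto a.
  by apply/mapP; exists i; rewrite ?mem_enum.
move=> [b i] [c j] [] /= eq1 /u_abs_inj eij.
by move: eq1; rewrite eij => /addIb ->.
Qed.

Definition signed_perm_of : {perm pm n} := perm signed_extension_inj.

Lemma signed_perm_of_signed : signed_perm_of \in signed_perms n.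
Proof.
by rewrite inE; apply/forallP => x; rewrite !permE /signed_extension /pm_opp /= addNb.
Qed.

Lemma signed_perm_ofE (i : 'I_n) : signed_perm_of (pm_pos i) = u i.
Proof. by rewrite permE /signed_extension /= -surjective_pairing. Qed.

End SignedPermOfWord.

(** * Sufficiency: the zigzag arrangement of an admissible word *)

Section Realization.

Variables (n : nat) (t : n.-tuple (option bool)).

Definition pm_sort (s : seq (pm n)) : seq (pm n) :=
  sort (relpre (@pm_val n) <=%O) s.

Lemma pm_sort_sorted (s : seq (pm n)) :
  uniq s -> sorted <%O (map (@pm_val n) (pm_sort s)).
Proof.
move=> s_uniq; rewrite -sort_map sort_lt_sorted.
by rewrite (map_inj_uniq (@pm_val_inj n)).
Qed.

Definition pinnacles : seq (pm n) := pm_sort (enum (letter_set t)).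

Definition valleys : seq (pm n) :=
  pm_sort [seq (true, i) | i <- enum [set i | tnth t i == None]].

Lemma mem_pinnacles (x : pm n) : (x \in pinnacles) = (tnth t x.2 == Some x.1).
Proof. by rewrite mem_sort mem_enum inE. Qed.

Lemma mem_valleys (i : 'I_n) : ((true, i) \in valleys) = (tnth t i == None).
Proof.
rewrite mem_sort mem_map; last by move=> j k [].
by rewrite mem_enum inE.
Qed.

Lemma pinnacles_sorted : sorted <%O (map (@pm_val n) pinnacles).
Proof. exact/pm_sort_sorted/enum_uniq. Qed.

Lemma valleys_sorted : sorted <%O (map (@pm_val n) valleys).
Proof.
by apply: pm_sort_sorted; rewrite map_inj_uniq ?enum_uniq // => i j [].
Qed.

Lemma size_pinnacles : size pinnacles = #|letter_set t|.
Proof. by rewrite size_sort -cardE. Qed.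

Lemma size_valleys : size valleys = n - size pinnacles.
Proof.
rewrite size_pinnacles card_letter_set size_sort size_map -cardE.
rewrite (card_tuple_pred t (pred1 None)).
have := count_predC (pred1 None) t; rewrite size_tuple => sizeE.
by rewrite -[X in X - _]sizeE addnK.
Qed.

Hypothesis t_adm : admissible t.

(** Below a negative pinnacle [-a] lie only values of absolute value at least [a], so the ballot
    condition compares the counts. Below a positive one lie all valleys, and the size bound makes
    them more numerous than the pinnacles. *)
Lemma count_pinnacles_lt (x : pm n) : x \in pinnacles ->
  count (<= pm_val x)%O (map (@pm_val n) pinnacles) <
  count (< pm_val x)%O (map (@pm_val n) valleys).
Proof.
have [lt_n adm] := admissibleP t t_adm.
rewrite mem_pinnacles !count_map => /eqP; case: x => [[] i] /= tiE.
  rewrite !count_sort count_map !count_enum.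
  apply: leq_ltn_trans (leq_trans (adm i tiE) _).
    have tI : injective (fun j : 'I_n => (true, j)) by move=> j k [].
    rewrite -(card_imset _ tI); apply/subset_leq_card/subsetP => -[b j].
    rewrite !inE /= => /andP[/eqP tjE]; case: b tjE => tjE; last first.
      by rewrite /pm_val /=; lia.
    move=> le_ij; apply/imsetP; exists j => //; rewrite inE tjE eqxx andbT.
    by move: le_ij; rewrite /pm_val /=; lia.
  apply/subset_leq_card/subsetP => j; rewrite !inE /= => /andP[le_ij /eqP tjE].
  rewrite tjE eqxx /= /pm_val /= .
  have : i != j by apply/eqP => eij; rewrite -eij tiE in tjE.
  by rewrite -val_eqE /=; lia.
apply: leq_ltn_trans (count_size _ _) _.
rewrite (eq_in_count (a2 := predT)) ?count_predT; last first.
  move=> y; rewrite mem_sort => /mapP[j _ ->] /=.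
  by rewrite /pm_val /=; lia.
by rewrite size_valleys size_pinnacles; lia.
Qed.

Hypothesis n_gt0 : 0 < n.

Let x0 : pm n := (false, Ordinal n_gt0).
Let k := size pinnacles.
Let s_ i : pm n := nth x0 pinnacles i.
Let v_ i : pm n := nth x0 valleys i.

Lemma lt_size_pinnacles : k.*2 < n.
Proof. by rewrite /k size_pinnacles; have [] := admissibleP t t_adm. Qed.

Lemma valley_ltn (i j : nat) : i < j < n - k -> pm_lt (v_ i) (v_ j).
Proof.
move=> /andP[lt_ij lt_j]; rewrite -size_valleys in lt_j.
have lt_i := ltn_trans lt_ij lt_j.
rewrite /pm_lt -!(nth_map x0 (pm_val x0)) //.
by rewrite (lt_sorted_ltn_nth _ valleys_sorted) // inE size_map.
Qed.

(** Exactly [i + 1] pinnacles are at most [s_ i], so at least [i + 2] valleys are below it, among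
    them [v_ i.+1]. *)
Lemma valley_lt_pinnacle (i : nat) : i < k -> pm_lt (v_ i.+1) (s_ i).
Proof.
move=> lt_ik; have := @count_pinnacles_lt (s_ i) (mem_nth _ lt_ik).
have sE : pm_val (s_ i) = nth (pm_val x0) (map (@pm_val n) pinnacles) i.
  by rewrite (nth_map x0).
rewrite {1}sE (count_le_nth _ pinnacles_sorted) ?size_map // => lt_cnt.
rewrite /pm_lt ltNge; apply/negP => le_sv.
have lt_iv : i.+1 < size valleys.
  by apply: leq_trans lt_cnt _; rewrite -(size_map (@pm_val n)) count_size.
suff : count (< pm_val (s_ i))%O (map (@pm_val n) valleys) <= i.+1.
  by rewrite leqNgt lt_cnt.
have vE : pm_val (v_ i.+1) = nth (pm_val x0) (map (@pm_val n) valleys) i.+1.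
  by rewrite (nth_map x0).
rewrite -[leqRHS](count_lt_nth (pm_val x0) valleys_sorted) ?size_map // -vE.
by apply: sub_count => z /= lt_zs; apply: lt_le_trans le_sv.
Qed.

(* The arrangement [v_0 s_0 v_1 s_1 ... v_(k-1) s_(k-1) v_k v_(k+1) ...]. *)
Definition zigzag (j : nat) : pm n :=
  if j <= k.*2 then (if odd j then s_ j./2 else v_ j./2) else v_ (j - k).

Lemma zigzag_pinnacle (i : nat) : i < k -> zigzag i.*2.+1 = s_ i.
Proof.
move=> lt_ik; rewrite /zigzag ltn_double lt_ik /= odd_double /=.
by rewrite uphalf_double.
Qed.

Lemma zigzag_valley (i : nat) : i <= k -> zigzag i.*2 = v_ i.
Proof.
by move=> le_ik; rewrite /zigzag leq_double le_ik odd_double doubleK.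
Qed.

(** The two branches of [zigzag] agree at [j = 2 k], where [j./2 = j - k = k]. *)
Lemma zigzag_tail (j : nat) : k.*2 <= j -> zigzag j = v_ (j - k).
Proof.
rewrite leq_eqVlt => /predU1P[<-|lt_kj].
  by rewrite zigzag_valley // -addnn addnK.
by rewrite /zigzag leqNgt lt_kj.
Qed.

Lemma zigzag_abs_onto (a : 'I_n) : exists i : 'I_n, (zigzag i).2 = a.
Proof.
have lt_kn := lt_size_pinnacles.
case taE : (tnth t a) => [b|].
  have Sx : (b, a) \in pinnacles by rewrite mem_pinnacles taE.
  set i := index (b, a) pinnacles.
  have lt_ik : i < k by rewrite index_mem.
  have lt_in : i.*2.+1 < n by lia.
  by exists (Ordinal lt_in); rewrite /= zigzag_pinnacle // /s_ nth_index.
have Vx : (true, a) \in valleys by rewrite mem_valleys taE.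
set i := index (true, a) valleys.
have lt_iv : i < n - k by rewrite -size_valleys index_mem.
have vE : v_ i = (true, a) by rewrite /v_ nth_index.
(* The valley of rank [i] sits at position [2 i] up to rank [k], and at [i + k] beyond. *)
have [le_ik|lt_ki] := leqP i k.
  have lt_in : i.*2 < n by lia.
  by exists (Ordinal lt_in); rewrite /= zigzag_valley // vE.
have lt_in : i + k < n by lia.
exists (Ordinal lt_in); rewrite /= zigzag_tail ?addnK ?vE //.
by rewrite -addnn leq_add2r ltnW.
Qed.

Lemma pm_lt_trans : transitive (@pm_lt n).
Proof. by move=> x y z; apply: lt_trans. Qed.

Lemma pm_lt_asym (x y : pm n) : pm_lt x y -> pm_lt y x -> False.
Proof. by rewrite /pm_lt => lt_xy; rewrite ltNge (ltW lt_xy). Qed.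

Lemma letter_set_APSB : letter_set t \in APSB n.
Proof.
have lt_kn := lt_size_pinnacles.
pose w := signed_perm_of zigzag_abs_onto.
apply/imsetP; exists w; first exact: signed_perm_of_signed.
apply/setP => x; rewrite [RHS]inE inE -mem_pinnacles.
have wE (i : 'I_n) : w (pm_pos i) = zigzag i by rewrite signed_perm_ofE.
apply/idP/existsP => [Sx|[i /existsP[j /existsP[l]]]].
  set m := index x pinnacles.
  have lt_mk : m < k by rewrite index_mem.
  have lt0 : m.*2 < n by lia.
  have lt1 : m.*2.+1 < n by lia.
  have lt2 : m.+1.*2 < n by lia.
  exists (Ordinal lt0); apply/existsP; exists (Ordinal lt1); apply/existsP.
  exists (Ordinal lt2); rewrite !wE zigzag_pinnacle // !zigzag_valley //; last exact: ltnW.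
  have lt_vs := valley_lt_pinnacle lt_mk.
  rewrite /= lt_vs /s_ nth_index // !eqxx andbT /=.
  (* The left neighbour is lower by [v_ m < v_ m.+1 < s_ m]. *)
  rewrite -[X in pm_lt _ X](nth_index x0 Sx); apply: pm_lt_trans (lt_vs).
  by apply: valley_ltn; lia.
rewrite !wE => /and5P[/eqP jE /eqP lE /eqP -> lt_i lt_l].
(* Beyond position [2 k] the tail increases, so the right neighbour is higher; at an even position
   up to [2 k] the left neighbour is a higher pinnacle. Only the odd positions below [2 k]
   remain. *)
have lt_ln := ltn_ord l.
have [lt_kj|le_jk] := ltnP k.*2 j.
  rewrite lE !zigzag_tail in lt_l; try by lia.
  by case: (pm_lt_asym lt_l); apply: valley_ltn; lia.
have [j_odd|j_even] := boolP (odd j).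
  have lt_mk : j./2 < k by lia.
  have -> : (j : nat) = j./2.*2.+1 by lia.
  by rewrite zigzag_pinnacle ?mem_nth.
have lt_mk : i./2 < k by lia.
have iE : (i : nat) = i./2.*2.+1 by lia.
have jE' : (j : nat) = (i./2).+1.*2 by lia.
rewrite iE jE' zigzag_pinnacle // zigzag_valley // in lt_i.
by case: (pm_lt_asym lt_i); exact: valley_lt_pinnacle.
Qed.

End Realization.

(** * Both inclusions and the final count *)

Lemma APSB_letter_sets (n : nat) : 0 < n ->
  APSB n = @letter_set n @: [set t | admissible t].
Proof.
move=> n_gt0; apply/setP => S; apply/idP/imsetP => [/imsetP[w sw ->]|[t]].
  have [t t_adm wE] := pinnacle_set_admissible n_gt0 sw.
  by exists t; rewrite // inE.
by rewrite inE => t_adm ->; apply: letter_set_APSB.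
Qed.

Theorem theorem3p12 (n : nat) (hn : 2 <= n) :
  #|APSB n| =
    \sum_(0 <= k < ((n - 1) %/ 2).+1)
      'C(n, k) * 'C(n - 1 - k, (n - 1) %/ 2 - k).
Proof.
have n_gt0 : 0 < n by apply: ltnW.
rewrite APSB_letter_sets // card_imset; last exact: letter_set_inj.
exact: card_admissible.
Qed.
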